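(* Let $A$ be a finite alphabet, $\{F_a:a\in A\}$ a Möbius iterative system, $\Sigma\subseteq A^\omega$ a sofic subshift and $\mathcal{W}=\{W_a:a\in A\}$ an interval almost cover with which $\Sigma$ is compatible, such that the set $\{F_v^{-1}(W_v):v\in A^*\}$ is finite. Then $\Sigma_{\mathcal{W}}$ is sofic.
   Context: $\mathbb{T}$ is the unit circle in $\mathbb{C}$. A disc preserving Möbius transformation is a map $F(z)=\frac{\alpha z+\beta}{\overline\beta z+\overline\alpha}$ with $|\alpha|^2-|\beta|^2=1$. A Möbius iterative system is a family $\{F_a:a\in A\}$ of disc preserving Möbius transformations. For a finite word $v=v_0\cdots v_{n-1}$ put $F_v=F_{v_0}\circ\cdots\circ F_{v_{n-1}}$ ($F_\lambda=\mathrm{id}$). $A^*$ is the set of finite words over $A$ (including the empty word $\lambda$), $A^\omega$ the set of one-sided infinite words with the product topology; $w_{[0,n)}=w_0\cdots w_{n-1}$. A subshift is a closed set $\Sigma\subseteq A^\omega$ with $\sigma(\Sigma)\subseteq\Sigma$, where $\sigma(w)_i=w_{i+1}$. $\mathcal{L}(\Sigma)$ is the set of all finite words that are factors of some $w\in\Sigma$. A subshift $\Sigma$ is sofic if $\mathcal{L}(\Sigma)$ is a regular language. An interval almost cover is a family $\mathcal{W}=\{W_a:a\in A\}$ where each $W_a$ is a union of finitely many (possibly zero) open intervals on $\mathbb{T}$ and $\bigcup_{a\in A}\overline{W_a}=\mathbb{T}$. Refined sets: $W_\lambda=\mathbb{T}$ and $W_u=W_{u_0}\cap F_{u_0}(W_{u_1})\cap\cdots\cap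 F_{u_{[0,n-1)}}(W_{u_{n-1}})$ for $u$ of length $n\geq1$. A nonempty subshift $\Sigma$ is compatible with $\mathcal{W}$ if for every $v\in\mathcal{L}(\Sigma)$, $\overline{W_v}=\bigcup_{a\in A,\,va\in\mathcal{L}(\Sigma)}\overline{W_{va}}$. The interval shift is $\Sigma_{\mathcal{W}}=\{w\in\Sigma:\forall n,\ W_{w_{[0,n)}}\ne\emptyset\}$ (a subshift). *)

(* Defs.v *)
From HB Require Import structures.
From mathcomp Require Import all_boot all_order all_algebra.
From mathcomp Require Import all_classical all_reals all_analysis.
From mathcomp Require Export complex.

Set Implicit Arguments.
Unset Strict Implicit.
Unset Printing Implicit Defensive.

Import Order.TTheory GRing.Theory Num.Theory numFieldNormedType.Exports.

Local Open Scope classical_set_scope.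
Local Open Scope ring_scope.

Section SymbolicDynamics.
Context {A : finType}.

Definition shift (w : nat -> A) : nat -> A := fun i => w i.+1.

Definition is_subshift (S : set (nat -> A)) : Prop :=
  @closed (prod_topology (fun _ : nat => discrete_topology A)) S /\
  shift @` S `<=` S.

Definition lang (S : set (nat -> A)) : set (seq A) :=
  [set v | exists2 w, S w & exists k, v = mkseq (fun i => w (k + i)%N) (size v)].

Record dfa := Dfa {
  dfa_state : finType;
  dfa_init : dfa_state;
  dfa_final : pred dfa_state;
  dfa_trans : dfa_state -> A -> dfa_state }.

Definition dfa_accept (M : dfa) (v : seq A) : bool :=
  dfa_final (foldl (@dfa_trans M) (dfa_init M) v).

Definition regular (L : set (seq A)) : Prop :=
  exists M : dfa, L = [set v | dfa_accept M v].

Definition sofic (S : set (nat -> A)) : Prop :=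
  is_subshift S /\ regular (lang S).

End SymbolicDynamics.

Section Circle.
Variable R : realType.

Definition circle : set R[i] := [set z | `|z| = 1].

(* The ascription selects the norm topology of C. As the circle is closed,
   the closure of one of its subsets is the same in the circle and in C. *)
Definition cl (X : set R[i]) : set R[i] := @closure (R[i] : numFieldType) X.

Definition open_arc (a b : R) : set R[i] :=
  [set (cos t +i* sin t)%C | t in [set t | a < t < b]].

(* b = a + 2 pi gives the circle minus a point; the whole circle is the union
   of two arcs, so whether it counts as an interval is immaterial for finite
   unions. *)
Definition is_open_interval (I : set R[i]) : Prop :=
  exists a b : R, [/\ a < b, b <= a + 2 * pi & I = open_arc a b].

Definition finite_union_open_intervals (X : set R[i]) : Prop :=
  exists (n : nat) (I : 'I_n -> set R[i]),
    (forall k, is_open_interval (I k)) /\ X = \bigcup_k I k.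

Record disc_mobius := DiscMobius {
  mobius_alpha : R[i];
  mobius_beta : R[i];
  mobius_norm : `|mobius_alpha| ^+ 2 - `|mobius_beta| ^+ 2 = 1 }.

(* The value at the pole is the junk value 0; the pole is never on the circle,
   since `|beta| < `|alpha|, and only the action on the circle is used. *)
Definition mobius_fun (F : disc_mobius) (z : R[i]) : R[i] :=
  (mobius_alpha F * z + mobius_beta F) /
  (Num.conj (mobius_beta F) * z + Num.conj (mobius_alpha F)).

Variable A : finType.
Implicit Types (F : A -> disc_mobius) (W : A -> set R[i]) (v u : seq A).

Definition word_map F v : R[i] -> R[i] :=
  foldr (fun a g => mobius_fun (F a) \o g) id v.

Definition interval_almost_cover W : Prop :=
  (forall a, finite_union_open_intervals (W a)) /\
  \bigcup_a cl (W a) = circle.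

(* Intersecting with the circle only matters for the empty word. *)
Definition refined F W u : set R[i] :=
  circle `&` \bigcap_(i : 'I_(size u))
    (word_map F (take i u) @` W (tnth (in_tuple u) i)).

Definition refined_preimage F W v : set R[i] :=
  circle `&` word_map F v @^-1` refined F W v.

Definition compatible F (S : set (nat -> A)) W : Prop :=
  S !=set0 /\
  forall v, lang S v ->
    cl (refined F W v) =
    \bigcup_(a in [set a | lang S (rcons v a)]) cl (refined F W (rcons v a)).

Definition interval_shift F (S : set (nat -> A)) W : set (nat -> A) :=
  [set w | S w /\ forall n, refined F W (mkseq w n) !=set0].

End Circle.

(* Main.v *)
Require Import Defs.
From mathcomp Require Import all_boot all_order all_algebra.
From mathcomp Require Import all_classical all_reals all_analysis.
From mathcomp Require Import finmap ring.

(** Write Q_v for the set F_v^-1(W_v). Refined sets obey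
      W_{va} = W_v `&` F_v(W_a),
    and F_v is a bijection of the circle, so pulling back along F_{va} gives
      Q_{va} = F_a^-1(Q_v `&` W_a).
    Thus Q_{va} depends on Q_v and a alone: the sets Q_v are the states of a
    deterministic automaton, which is finite by hypothesis, and which decides
    whether W_v is nonempty because W_v is nonempty exactly when Q_v is. Run
    in parallel with an automaton for the language of S, it recognises
      L = {v in lang S | W_v nonempty}.

    It remains to see that L is the language of the interval shift. A factor
    of a point of the interval shift is a prefix of another point
    ([lang_prefixP]), so it lies in L. Conversely, compatibility writes the
    closure of W_v as the union of the closures of the W_{va} with va in
    lang S; if W_v is nonempty, so is one of the W_{va}. Every word of L
    therefore has a one-letter extension in L, and hence extends to an infinite
    word with all prefixes in L ([prolongable_extend]), which belongs to S
    since S is closed ([closed_prefixP]).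

    That the interval shift is a subshift is elementary: membership is a
    condition on finite prefixes, and W_{av} is contained in F_a(W_v)
    ([refined_cons]), so deleting the first letter keeps refined sets
    nonempty. *)

Set Implicit Arguments.
Unset Strict Implicit.

Local Open Scope classical_set_scope.

(** * Words and subshifts *)

Section Words.
Context {A : finType}.
Implicit Types (S : set (nat -> A)) (w : nat -> A) (v : seq A).

Local Notation words := (prod_topology (fun _ : nat => discrete_topology A)).

Lemma nbhs_cylinder w n :
  nbhs (w : words) [set u : words | mkseq u n = mkseq w n].
Proof.
elim: n => [|n IHn]; first by apply: filterS filterT.
have Hn : nbhs (w : words) (proj n @^-1` [set w n : discrete_topology A]).
  apply: proj_continuous; apply: open_nbhs_nbhs.
  by split; first exact: discrete_open.
apply: filterS (filterI IHn Hn) => u [/= un uw].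
by rewrite !mkseqS un -uw.
Qed.

(** Cylinders are neighbourhoods, and words that agree with w on longer and
    longer prefixes converge to w; so closedness can be tested on prefixes
    alone. *)
Lemma closed_prefixP S :
  @closed words S <->
  forall w, (forall n, exists2 u, S u & mkseq u n = mkseq w n) -> S w.
Proof.
split=> [clS w approx | approx w Sw]; last first.
  apply: approx => n.
  by have [u [Su un]] := Sw _ (nbhs_cylinder w n); exists u.
have /choice[u_ u_P] : forall n, exists u, S u /\ mkseq u n = mkseq w n.
  by move=> n; have [u] := approx n; exists u.
have u_w : u_ @ \oo --> (w : words).
  apply/(pointwise_cvgP (U := nat) (V := discrete_topology A)) => i.
  apply/discrete_cvg; exists i.+1 => // n /= i_lt.
  have [_ /(congr1 (nth (w i) ^~ i))] := u_P n.
  by rewrite !nth_mkseq.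
apply: (@closed_cvg nat words \oo _ u_ S clS _ w u_w).
by apply: nearW => n; have [] := u_P n.
Qed.

Lemma mkseq_eq w w' m n : (m <= n)%N -> mkseq w n = mkseq w' n ->
  mkseq w m = mkseq w' m.
Proof.
move=> mn /(congr1 (take m)).
by rewrite /mkseq -!map_take take_iota (minn_idPl mn).
Qed.

(** Shifting a point until a given factor comes first turns factors into
    prefixes. *)
Lemma lang_prefixP S v : Defs.shift @` S `<=` S ->
  lang S v <-> exists2 w, S w & mkseq w (size v) = v.
Proof.
move=> shiftS; split=> [[w Sw [k ->]]|[w Sw <-]]; last first.
  by exists w => //; exists 0%N; rewrite size_mkseq.
rewrite size_mkseq; exists (fun i => w (k + i)%N) => //.
elim: k => [//|k IHk].
rewrite (_ : (fun _ => _) = Defs.shift (fun i => w (k + i)%N)).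
  by apply: shiftS; exists (fun i => w (k + i)%N).
by apply/funext => i; rewrite /Defs.shift addnS.
Qed.

(** Choosing a one-letter extension again and again produces a chain of words,
    each a prefix of the next, whose union is the infinite word. *)
Lemma prolongable_extend (P : set (seq A)) v :
  (forall u, P u -> exists a, P (rcons u a)) -> P v ->
  exists w, mkseq w (size v) = v /\ forall n, (size v <= n)%N -> P (mkseq w n).
Proof.
move=> prolong Pv; have [a0 _] := prolong v Pv.
have /choice[next nextP] : forall u, exists a, P u -> P (rcons u a).
  move=> u; have [/prolong[a Pa]|nPu] := pselect (P u); first by exists a.
  by exists a0.
pose chain n := iter n (fun u => rcons u (next u)) v.
have chain_size n : size (chain n) = (n + size v)%N.
  by elim: n => //= n IHn; rewrite size_rcons IHn.
have chainP n : P (chain n) by elim: n => //= n; exact: nextP.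
have chain_nth m n i : (m <= n)%N -> (i < m + size v)%N ->
    nth a0 (chain n) i = nth a0 (chain m) i.
  move=> /subnK <- im; elim: (n - m)%N => //= k <-.
  by rewrite nth_rcons chain_size -addnA (leq_trans im) // leq_addl.
(* chain i.+1 has at least i.+1 letters, so the default a0 is never read. *)
pose w i := nth a0 (chain i.+1) i.
have wE n : mkseq w (n + size v) = chain n.
  apply: (@eq_from_nth _ a0) => [|i]; rewrite size_mkseq ?chain_size// => i_lt.
  rewrite nth_mkseq// /w; have [ni|ni] := leqP n i.+1.
    by rewrite (chain_nth n).
  by apply/esym/chain_nth; [exact: ltnW|exact: leq_addr].
exists w; split=> [|n /subnK <-]; first exact: (wE 0%N).
by rewrite wE.
Qed.

(** The easy half of the Myhill-Nerode theorem: g makes T the state space of a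
    possibly infinite automaton whose state after reading v is f v. Only the
    finitely many values of f are reachable, so T can be cut down to them. *)
Lemma regular_finite_range (T : choiceType) (f : seq A -> T) (g : T -> A -> T)
    (P : set T) :
  finite_set (range f) -> (forall v a, f (rcons v a) = g (f v) a) ->
  regular [set v | P (f v)].
Proof.
move=> /finite_fsetP[X fX] fg.
have fin v : f v \in X by have : range f (f v) by []; rewrite fX.
pose init : X := FSetSub (fin [::]).
(* X consists of values of f and is therefore stable under g: insubd never
   falls back on init. *)
pose M := @Dfa A X init (fun x => `[<P (val x)>])
  (fun x a => insubd init (g (val x) a)).
have run v : val (foldl (@dfa_trans _ M) (dfa_init M) v) = f v.
  elim/last_ind: v => [//|v a IHv]; rewrite foldl_rcons /= val_insubd IHv -fg.
  by rewrite fin.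
exists M; apply/seteqP; split=> v /=; rewrite /dfa_accept /= -run.
  by move=> ?; apply/asboolP.
by move/asboolP.
Qed.

End Words.

(** * Disc preserving Moebius transformations on the circle *)

Section Moebius.
Variable R : realType.
Import GRing.Theory Num.Theory.
Local Open Scope ring_scope.
Implicit Types (F : disc_mobius R) (z : complex R).

Local Notation "x ^*" := (Num.conj x).

Lemma mobius_det F :
  mobius_alpha F * (mobius_alpha F)^* - mobius_beta F * (mobius_beta F)^* = 1.
Proof. by rewrite -!normCK mobius_norm. Qed.

(** A zero of the denominator on the circle would force |alpha| = |beta|. *)
Lemma mobius_denom_neq0 F z : circle z ->
  (mobius_beta F)^* * z + (mobius_alpha F)^* != 0.
Proof.
rewrite /circle /= => z1; apply/negP.
rewrite addrC addr_eq0 => /eqP/(congr1 Num.norm).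
rewrite normrN normrM z1 mulr1 !norm_conjC => eq_norm.
have := mobius_norm F; rewrite eq_norm subrr => /eqP.
by rewrite eq_sym oner_eq0.
Qed.

(** On the circle the conjugate of z is its inverse, so the numerator is z times
    the conjugate of the denominator, and both have the same modulus. *)
Lemma mobius_circle F z : circle z -> circle (mobius_fun F z).
Proof.
move=> z1; have := mobius_denom_neq0 F z1; move: z1.
rewrite /circle /mobius_fun /=.
set a := mobius_alpha F; set b := mobius_beta F => z1 d0.
have -> : a * z + b = z * (b^* * z + a^*)^*.
  have zz : z * z^* = 1 by rewrite -normCK z1 expr1n.
  by rewrite rmorphD rmorphM /= !conjCK mulrDr mulrCA zz mulr1 addrC [a * z]mulrC.
by rewrite normrM normrM norm_conjC z1 mul1r normfV divff // normr_eq0.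
Qed.

(** The matrix of a disc preserving map has determinant 1, so its adjugate
    represents the inverse map, and the adjugate has the same form. *)
Lemma mobius_inv_norm F :
  `|(mobius_alpha F)^*| ^+ 2 - `|- mobius_beta F| ^+ 2 = 1.
Proof. by rewrite norm_conjC normrN mobius_norm. Qed.

Definition mobius_inv F : disc_mobius R := DiscMobius (mobius_inv_norm F).

Lemma mobius_invK F z : circle z ->
  mobius_fun (mobius_inv F) (mobius_fun F z) = z.
Proof.
move=> /(mobius_denom_neq0 F); have := mobius_det F.
rewrite /mobius_fun /= rmorphN /= conjCK.
set a := mobius_alpha F; set b := mobius_beta F.
(* From here on the conjugates are independent scalars related only by the
   determinant identity. *)
move: (a^*) (b^*) => a' b' det; set d := b' * z + a' => d0.
have -> : a' * ((a * z + b) / d) + - b = z / d.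
  apply: (mulIf d0); rewrite mulrDl !mulrA !divfK // /d.
  by rewrite -[RHS]mulr1 -det; ring.
have -> : - b' * ((a * z + b) / d) + a = d^-1.
  apply: (mulIf d0); rewrite mulrDl !mulrA divfK // mulVf // /d.
  by rewrite -det; ring.
by rewrite invrK divfK.
Qed.

Lemma mobius_invKV F z : circle z ->
  mobius_fun F (mobius_fun (mobius_inv F) z) = z.
Proof.
move=> z1; rewrite -[RHS](mobius_invK (mobius_inv F)) //.
by rewrite /mobius_fun /= rmorphN /= conjCK opprK.
Qed.

Lemma mobius_bij F : set_bij (@circle R) (@circle R) (mobius_fun F).
Proof.
split=> [z|x y|z z1]; first exact: mobius_circle.
  move=> /set_mem x1 /set_mem y1 /(congr1 (mobius_fun (mobius_inv F))).
  by rewrite !mobius_invK.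
exists (mobius_fun (mobius_inv F) z); first exact: mobius_circle.
exact: mobius_invKV.
Qed.

Lemma word_map_bij (A : finType) (F : A -> disc_mobius R) v :
  set_bij (@circle R) (@circle R) (word_map F v).
Proof.
elim: v => [|a v IHv] /=; first by split=> // z; exists z.
exact: set_bij_comp IHv (mobius_bij (F a)).
Qed.

End Moebius.

(** * Refined sets *)

Section Refined.
Variables (R : realType) (A : finType) (F : A -> disc_mobius R).
Variable W : A -> set (complex R).
Hypothesis W_circle : forall a, W a `<=` @circle R.
Implicit Types v : seq A.

Lemma word_map_rcons v a z :
  word_map F (rcons v a) z = word_map F v (mobius_fun (F a) z).
Proof. by elim: v => //= b v ->. Qed.

Lemma refined_nil : refined F W [::] = @circle R.
Proof. by apply/seteqP; split=> [z []|z z1] //; split=> // -[]. Qed.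

Lemma refined_rcons v a :
  refined F W (rcons v a) = refined F W v `&` word_map F v @` W a.
Proof.
apply/seteqP; split=> [z [z1 vaz]|z [[z1 vz] az]].
  split.
    split=> // i _; have i_lt : (i < size (rcons v a))%N.
      by rewrite size_rcons ltnS ltnW.
    have := vaz (Ordinal i_lt) I; rewrite /= !(tnth_nth a) /=.
    by rewrite nth_rcons ltn_ord -cats1 takel_cat // ltnW.
  have i_lt : (size v < size (rcons v a))%N by rewrite size_rcons.
  have := vaz (Ordinal i_lt) I; rewrite /= !(tnth_nth a) /=.
  by rewrite nth_rcons ltnn eqxx -cats1 take_size_cat.
split=> // -[i i_lt] _; rewrite (tnth_nth a) /=.
move: (i_lt); rewrite size_rcons ltnS leq_eqVlt => /predU1P[iv|iv].
  by rewrite iv nth_rcons ltnn eqxx -cats1 take_size_cat.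
have := vz (Ordinal iv) I; rewrite (tnth_nth a) /=.
by rewrite nth_rcons iv -cats1 takel_cat // ltnW.
Qed.

(** In fact W_{av} is the intersection of W_a with F_a(W_v). This inclusion is
    what makes nonemptiness of refined sets survive the shift. *)
Lemma refined_cons a v :
  refined F W (a :: v) `<=` mobius_fun (F a) @` refined F W v.
Proof.
have [_ Finj Fsurj] := mobius_bij (F a).
elim/last_ind: v => [|v b IHv].
  by rewrite refined_nil => z [z1 _]; exact: Fsurj.
rewrite -rcons_cons refined_rcons => z [/IHv[y vy <-] [x Wx /= xy]].
exists y => //; rewrite refined_rcons; split=> //; exists x => //.
have [vmap _ _] := word_map_bij F v.
apply: Finj => //; apply: mem_set; last by case: vy.
by apply: vmap; exact: W_circle Wx.
Qed.

(** The key recursion: F_v cancels, so the next set is determined by the present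
    one and the letter read. *)
Lemma refined_preimage_rcons v a :
  refined_preimage F W (rcons v a) =
  @circle R `&` mobius_fun (F a) @^-1` (refined_preimage F W v `&` W a).
Proof.
have [_ vinj _] := word_map_bij F v.
have [Fa _ _] := mobius_bij (F a).
rewrite /refined_preimage refined_rcons.
apply/seteqP; split=> z [z1]; rewrite /= ?word_map_rcons.
  move=> [vz [y Wy yz]]; split=> //; have Faz := Fa z z1.
  split; first by split.
  by rewrite -(vinj _ _ _ _ yz) //; apply: mem_set => //; exact: W_circle Wy.
move=> [[_ vz] Wz]; split=> //; split=> //.
by exists (mobius_fun (F a) z).
Qed.

Lemma refined_preimage_nonempty v :
  refined_preimage F W v !=set0 <-> refined F W v !=set0.
Proof.
have [_ _ vsurj] := word_map_bij F v.
split=> [[z [_ vz]]|[z vz]]; first by exists (word_map F v z).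
have [y y1 yz] := vsurj z vz.1.
by exists y; split=> //=; rewrite yz.
Qed.

End Refined.

Lemma cover_sub_circle (R : realType) (A : finType) (W : A -> set (complex R)) a :
  interval_almost_cover W -> W a `<=` @circle R.
Proof.
move=> [_ <-] z Wz; exists a => //; exact: subset_closure.
Qed.

Lemma cl_nonempty (R : realType) (X : set (complex R)) :
  cl X !=set0 -> X !=set0.
Proof.
move=> [z Xz]; apply/set0P/eqP => X0; move: Xz.
by rewrite /cl X0 closure0.
Qed.

(** * The interval shift *)

Section IntervalShift.
Variables (R : realType) (A : finType) (F : A -> disc_mobius R).
Variables (S : set (nat -> A)) (W : A -> set (complex R)).
Hypothesis W_circle : forall a, W a `<=` @circle R.
Hypothesis subS : is_subshift S.

Lemma interval_shift_subshift : is_subshift (interval_shift F S W).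
Proof.
have [clS shS] := subS; split.
  apply/closed_prefixP => w approx; split.
    move/closed_prefixP: clS; apply=> n.
    by have [u [Su _] un] := approx n; exists u.
  by move=> n; have [u [_ uW] <-] := approx n; exact: uW.
move=> _ [w [Sw wW] <-]; split; first by apply: shS; exists w.
move=> n; have := wW n.+1; rewrite /mkseq /= (iotaDl 1 0) -map_comp.
by move=> [z /(refined_cons W_circle)[y vy _]]; exists y.
Qed.

Hypothesis compS : compatible F S W.

(** A word of the language of S with nonempty refined set cannot be a dead end:
    by compatibility some one-letter extension has these properties again. *)
Lemma lang_interval_shift :
  lang (interval_shift F S W) = [set v | lang S v /\ refined F W v !=set0].
Proof.
have [clS shS] := subS; have [_ shI] := interval_shift_subshift.
apply/seteqP; split=> v.
  move/(lang_prefixP _ shI) => [w [Sw wW] <-]; split; last exact: wW.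
  by apply/(lang_prefixP _ shS); exists w; rewrite ?size_mkseq.
move=> Pv; apply/(lang_prefixP _ shI).
have prolong u : lang S u /\ refined F W u !=set0 ->
    exists a, lang S (rcons u a) /\ refined F W (rcons u a) !=set0.
  move=> [Lu [z uz]]; have : cl (refined F W u) z by exact: subset_closure.
  rewrite compS.2 // => -[a /= Lua ua]; exists a; split=> //.
  by apply: cl_nonempty; exists z.
have [w [wv wP]] := prolongable_extend prolong Pv.
exists w => //; split.
  move/closed_prefixP: clS; apply=> n.
  have [/(lang_prefixP _ shS)[u Su]] := wP (maxn (size v) n) (leq_maxl _ _).
  rewrite size_mkseq => /(mkseq_eq (leq_maxr _ _)) un _.
  by exists u.
(* Prefixes shorter than v need a separate argument: refined sets decrease
   along prefixes. *)
move=> n; have [_] := wP (n + size v)%N (leq_addl _ _).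
elim: (size v) => [|k IHk]; first by rewrite addn0.
by rewrite addnS mkseqS refined_rcons => -[z [nz _]]; apply: IHk; exists z.
Qed.

End IntervalShift.

Unset Implicit Arguments.
Set Strict Implicit.

Theorem theorem37 (R : realType) (A : finType) (F : A -> disc_mobius R)
    (S : set (nat -> A)) (W : A -> set (complex R)) :
  sofic S ->
  interval_almost_cover W ->
  compatible F S W ->
  finite_set [set refined_preimage F W v | v in [set: seq A]] ->
  sofic (interval_shift F S W).
Proof.
move=> [subS [M LM]] coverW compS finQ.
have W_circle a := @cover_sub_circle R A W a coverW.
split; first exact: interval_shift_subshift.
rewrite lang_interval_shift // LM.
pose state v := (foldl (@dfa_trans _ M) (dfa_init M) v, refined_preimage F W v).
pose step q a := (@dfa_trans _ M q.1 a,
  @circle R `&` mobius_fun (F a) @^-1` (q.2 `&` W a)).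
pose final (q : dfa_state M * set (complex R)) := dfa_final q.1 /\ q.2 !=set0.
have -> : [set v | [set v | dfa_accept M v] v /\ refined F W v !=set0] =
    [set v | final (state v)].
  by apply/seteqP; split=> v [Mv Wv]; split=> //; apply/refined_preimage_nonempty.
apply: (@regular_finite_range _ _ state step final).
  apply: sub_finite_set (finite_setX (@finite_finset _ setT) finQ).
  by move=> _ [v _ <-]; split=> //=; exists v.
by move=> v a; rewrite /state /step foldl_rcons refined_preimage_rcons.
Qed.
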